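(* Let $ds^2=2e^{v(x,y)}(dx^2+dy^2)$ be a metric on a surface $\Sigma$, where $v$ is a real function satisfying the Tzitzéica equation $$\Delta v=4(e^{-2v}-e^{v}),\qquad \Delta=\partial_x^2+\partial_y^2.$$ Then the functions $$s_1=v_x^2-v_y^2+v_{xx}-v_{yy},\qquad s_2=v_xv_y+v_{xy}$$ are eigenfunctions of the Laplace–Beltrami operator of $ds^2$ with eigenvalue $6$, i.e. $\Delta_{LB}s_j=6s_j$ for $j=1,2$.
   Context: Functions are smooth. The sign convention is $\Delta_{LB}=-\frac{1}{2e^{v}}\,(\partial_x^2+\partial_y^2)$ for the metric $2e^{v}(dx^2+dy^2)$, so $\Delta_{LB}s=6s$ is equivalent to $\Delta s+12e^{v}s=0$. ''Eigenfunction with eigenvalue $6$'' means a solution of this equation; it is not asserted that $s_1,s_2$ are not identically zero (for instance they vanish when $v$ is constant). *)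

(* Defs.v *)
From Stdlib Require Import Reals Lra.
From Coquelicot Require Import Coquelicot.
Open Scope R_scope.

Definition dx (f : R -> R -> R) : R -> R -> R :=
  fun x y => Derive (fun t => f t y) x.

Definition dy (f : R -> R -> R) : R -> R -> R :=
  fun x y => Derive (fun t => f x t) y.

Definition laplacian (f : R -> R -> R) : R -> R -> R :=
  fun x y => dx (dx f) x y + dy (dy f) x y.

(** [ex_diff_n f n x y] says that all iterated partial derivatives of [f] of
    order at most [n] exist at [(x, y)] and are continuous there, so on an
    open [U] this is C^oo.  [f] is a total function whose values outside [U]
    are irrelevant. *)
Definition smooth_on (U : R * R -> Prop) (f : R -> R -> R) : Prop :=
  forall (n : nat) (x y : R), U (x, y) -> ex_diff_n f n x y.

(** ds^2 = gE dx^2 + 2 gF dx dy + gG dy^2. *)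
Record metric := Metric {
  gE : R -> R -> R;
  gF : R -> R -> R;
  gG : R -> R -> R
}.

(** 2 e^v (dx^2 + dy^2). *)
Definition conformal_metric (v : R -> R -> R) : metric :=
  Metric (fun x y => 2 * exp (v x y))
         (fun _ _ => 0)
         (fun x y => 2 * exp (v x y)).

Definition area_density (g : metric) : R -> R -> R :=
  fun x y => sqrt (gE g x y * gG g x y - gF g x y ^ 2).

(** - (det g)^(-1/2) d_i ((det g)^(1/2) g^(ij) d_j f), with the sign making the
    operator nonnegative; the entries of the inverse matrix of g are
    gG / det g, - gF / det g and gE / det g. *)
Definition laplace_beltrami (g : metric) (f : R -> R -> R) : R -> R -> R :=
  fun x y =>
    - / area_density g x y *
      (dx (fun a b => (gG g a b * dx f a b - gF g a b * dy f a b)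
                      / area_density g a b) x y
       + dy (fun a b => (gE g a b * dy f a b - gF g a b * dx f a b)
                        / area_density g a b) x y).

Lemma area_density_conformal (v : R -> R -> R) (x y : R) :
  area_density (conformal_metric v) x y = 2 * exp (v x y).
Proof.
unfold area_density; simpl.
replace (2 * exp (v x y) * (2 * exp (v x y)) - 0 * (0 * 1))
  with (2 * exp (v x y) * (2 * exp (v x y))) by ring.
apply sqrt_square.
pose proof (exp_pos (v x y)); lra.
Qed.

Lemma laplace_beltrami_conformal (v f : R -> R -> R) (x y : R) :
  laplace_beltrami (conformal_metric v) f x y
  = - / (2 * exp (v x y)) * laplacian f x y.
Proof.
unfold laplace_beltrami, laplacian.
rewrite area_density_conformal.
f_equal; f_equal; apply Derive_ext; intro t;
  rewrite area_density_conformal; simpl; field; apply Rgt_not_eq, exp_pos.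
Qed.

(** The zero function is allowed. *)
Definition eigenfunction_on (U : R * R -> Prop) (g : metric) (lambda : R)
    (s : R -> R -> R) : Prop :=
  smooth_on U s /\
  forall x y : R, U (x, y) -> laplace_beltrami g s x y = lambda * s x y.

Definition tzitzeica_on (U : R * R -> Prop) (v : R -> R -> R) : Prop :=
  forall x y : R, U (x, y) ->
    laplacian v x y = 4 * (exp (-2 * v x y) - exp (v x y)).

Definition s1 (v : R -> R -> R) : R -> R -> R :=
  fun x y => dx v x y ^ 2 - dy v x y ^ 2 + dx (dx v) x y - dy (dy v) x y.

Definition s2 (v : R -> R -> R) : R -> R -> R :=
  fun x y => dx v x y * dy v x y + dy (dx v) x y.

(* Main.v *)
(** With [z = x + i y] one has [s1 - 2 i s2 = 4 (v_z^2 + v_zz)], while the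
    Tzitzeica equation reads [v_(z zbar) = e^(-2v) - e^v].  Hence
    [d/dzbar (v_z^2 + v_zz) = - 3 e^v v_z]: the terms in [e^(-2v)] cancel.
    Applying [4 d/dz] gives the eigenvalue equation. *)

Require Import Defs.
From Stdlib Require Import Reals Lra Lia.
From Coquelicot Require Import Coquelicot.
Open Scope R_scope.

(** The order is kept fixed so that closure under sums and products can be proved by induction on
    [n]; [smooth_on] is the conjunction over all [n]. *)
Definition Cn_on (U : R * R -> Prop) (n : nat) (f : R -> R -> R) : Prop :=
  forall x y : R, U (x, y) -> ex_diff_n f n x y.

(** * Localisation of identities and derivatives to an open set *)

Section Open_domain.

Variable U : R * R -> Prop.
Hypothesis hU : open U.

Lemma open_locally_2d (P : R -> R -> Prop) (x y : R) :
  (forall a b : R, U (a, b) -> P a b) -> U (x, y) -> locally_2d P x y.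
Proof.
intros HP Hxy; apply locally_2d_locally.
apply (filter_imp U); [intros [a b]; apply HP | now apply hU].
Qed.

Lemma open_locally_x (P : R -> Prop) (x y : R) :
  (forall a : R, U (a, y) -> P a) -> U (x, y) -> locally x P.
Proof.
intros HP Hxy.
apply (filter_imp (fun a => U (a, y))); [exact HP |].
apply (locally_2d_1d_const_y (fun a b => U (a, b))).
now apply open_locally_2d.
Qed.

Lemma open_locally_y (P : R -> Prop) (x y : R) :
  (forall b : R, U (x, b) -> P b) -> U (x, y) -> locally y P.
Proof.
intros HP Hxy.
apply (filter_imp (fun b => U (x, b))); [exact HP |].
apply (locally_2d_1d_const_x (fun a b => U (a, b))).
now apply open_locally_2d.
Qed.

(** A derivative depends only on values near the point, and [U] is open. This is what allows
    equations known only on [U] to be differentiated. *)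
Lemma dx_ext_on (f g : R -> R -> R) (x y : R) :
  (forall a b : R, U (a, b) -> f a b = g a b) -> U (x, y) ->
  dx f x y = dx g x y.
Proof.
intros Heq Hxy; apply Derive_ext_loc.
apply (open_locally_x _ _ y); [intros a; apply Heq | exact Hxy].
Qed.

Lemma dy_ext_on (f g : R -> R -> R) (x y : R) :
  (forall a b : R, U (a, b) -> f a b = g a b) -> U (x, y) ->
  dy f x y = dy g x y.
Proof.
intros Heq Hxy; apply Derive_ext_loc.
apply (open_locally_y _ x); [intros b; apply Heq | exact Hxy].
Qed.

(** * Closure properties of functions of class C^n *)

Lemma Cn_on_ext (n : nat) (f g : R -> R -> R) :
  (forall a b : R, U (a, b) -> f a b = g a b) -> Cn_on U n f -> Cn_on U n g.
Proof.
intros Heq Hf x y Hxy; apply (ex_diff_n_ext_loc f).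
- now apply open_locally_2d.
- now apply Hf.
Qed.

Lemma Cn_on_S (n : nat) (f : R -> R -> R) : Cn_on U (S n) f -> Cn_on U n f.
Proof.
intros Hf x y Hxy; apply (ex_diff_n_m (S n)); [lia | now apply Hf].
Qed.

Lemma Cn_on_dx (n : nat) (f : R -> R -> R) :
  Cn_on U (S n) f -> Cn_on U n (dx f).
Proof. intros Hf x y Hxy; apply ex_diff_n_deriv_aux1; now apply Hf. Qed.

Lemma Cn_on_dy (n : nat) (f : R -> R -> R) :
  Cn_on U (S n) f -> Cn_on U n (dy f).
Proof. intros Hf x y Hxy; apply ex_diff_n_deriv_aux2; now apply Hf. Qed.

Lemma Cn_on_continuity (n : nat) (f : R -> R -> R) (x y : R) :
  Cn_on U n f -> U (x, y) -> continuity_2d_pt f x y.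
Proof. intros Hf Hxy; generalize (Hf x y Hxy); now destruct n; intros []. Qed.

Lemma Cn_on_ex_dx (n : nat) (f : R -> R -> R) (x y : R) :
  Cn_on U (S n) f -> U (x, y) -> ex_derive (fun t => f t y) x.
Proof. intros Hf Hxy; apply (Hf x y Hxy). Qed.

Lemma Cn_on_ex_dy (n : nat) (f : R -> R -> R) (x y : R) :
  Cn_on U (S n) f -> U (x, y) -> ex_derive (fun t => f x t) y.
Proof. intros Hf Hxy; apply (Hf x y Hxy). Qed.

(** The recursion in [ex_diff_n] speaks of [Derive], which agrees with the explicit formulas [fx]
    and [fy] on [U]; [Cn_on_ext] transfers their regularity. *)
Lemma Cn_on_intro (n : nat) (f fx fy : R -> R -> R) :
  (forall x y : R, U (x, y) -> continuity_2d_pt f x y) ->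
  (forall x y : R, U (x, y) -> is_derive (fun t => f t y) x (fx x y)) ->
  (forall x y : R, U (x, y) -> is_derive (fun t => f x t) y (fy x y)) ->
  Cn_on U n fx -> Cn_on U n fy -> Cn_on U (S n) f.
Proof.
intros Hc Hx Hy Hfx Hfy x y Hxy; simpl; repeat split.
- now apply Hc.
- eexists; now apply Hx.
- eexists; now apply Hy.
- refine (Cn_on_ext n fx _ _ Hfx x y Hxy); intros a b Hab.
  symmetry; now apply is_derive_unique, Hx.
- refine (Cn_on_ext n fy _ _ Hfy x y Hxy); intros a b Hab.
  symmetry; now apply is_derive_unique, Hy.
Qed.

Lemma Cn_on_const (n : nat) (c : R) : Cn_on U n (fun _ _ => c).
Proof.
revert c; induction n as [|n IH]; intros c.
- intros x y _; split; [apply continuity_2d_pt_const | exact I].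
- apply (Cn_on_intro n _ (fun _ _ => 0) (fun _ _ => 0)); try apply IH;
    intros x y _;
    [apply continuity_2d_pt_const | apply @is_derive_const ..].
Qed.

Lemma Cn_on_plus (n : nat) (f g : R -> R -> R) :
  Cn_on U n f -> Cn_on U n g -> Cn_on U n (fun x y => f x y + g x y).
Proof.
revert f g; induction n as [|n IH]; intros f g Hf Hg.
- intros x y Hxy; split; [|exact I].
  apply continuity_2d_pt_plus; now apply (Cn_on_continuity 0).
- apply (Cn_on_intro n _ (fun x y => dx f x y + dx g x y)
                         (fun x y => dy f x y + dy g x y)).
  + intros x y Hxy.
    apply continuity_2d_pt_plus; now apply (Cn_on_continuity (S n)).
  + intros x y Hxy; apply @is_derive_plus; apply Derive_correct;
      now apply (Cn_on_ex_dx n).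
  + intros x y Hxy; apply @is_derive_plus; apply Derive_correct;
      now apply (Cn_on_ex_dy n).
  + apply IH; now apply Cn_on_dx.
  + apply IH; now apply Cn_on_dy.
Qed.

Lemma Cn_on_mult (n : nat) (f g : R -> R -> R) :
  Cn_on U n f -> Cn_on U n g -> Cn_on U n (fun x y => f x y * g x y).
Proof.
revert f g; induction n as [|n IH]; intros f g Hf Hg.
- intros x y Hxy; split; [|exact I].
  apply continuity_2d_pt_mult; now apply (Cn_on_continuity 0).
- apply (Cn_on_intro n _ (fun x y => dx f x y * g x y + f x y * dx g x y)
                         (fun x y => dy f x y * g x y + f x y * dy g x y)).
  + intros x y Hxy.
    apply continuity_2d_pt_mult; now apply (Cn_on_continuity (S n)).
  + intros x y Hxy.
    apply (is_derive_mult (fun t => f t y) (fun t => g t y));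
      [ | | exact Rmult_comm]; apply Derive_correct; now apply (Cn_on_ex_dx n).
  + intros x y Hxy.
    apply (is_derive_mult (fun t => f x t) (fun t => g x t));
      [ | | exact Rmult_comm]; apply Derive_correct; now apply (Cn_on_ex_dy n).
  (* In each Leibniz product the differentiated factor loses one order by differentiation, and the
     other is weakened to order [n]. *)
  + apply Cn_on_plus; apply IH;
      (now apply Cn_on_dx) || (now apply Cn_on_S).
  + apply Cn_on_plus; apply IH;
      (now apply Cn_on_dy) || (now apply Cn_on_S).
Qed.

(** * Smooth functions and symmetry of mixed derivatives *)

Lemma smooth_on_Cn (n : nat) (f : R -> R -> R) : smooth_on U f -> Cn_on U n f.
Proof. intros Hf; exact (Hf n). Qed.

Lemma smooth_on_dx (f : R -> R -> R) : smooth_on U f -> smooth_on U (dx f).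
Proof. intros Hf n; now apply Cn_on_dx, smooth_on_Cn. Qed.

Lemma smooth_on_dy (f : R -> R -> R) : smooth_on U f -> smooth_on U (dy f).
Proof. intros Hf n; now apply Cn_on_dy, smooth_on_Cn. Qed.

Lemma smooth_on_plus (f g : R -> R -> R) :
  smooth_on U f -> smooth_on U g -> smooth_on U (fun x y => f x y + g x y).
Proof. intros Hf Hg n; now apply Cn_on_plus; apply smooth_on_Cn. Qed.

Lemma smooth_on_mult (f g : R -> R -> R) :
  smooth_on U f -> smooth_on U g -> smooth_on U (fun x y => f x y * g x y).
Proof. intros Hf Hg n; now apply Cn_on_mult; apply smooth_on_Cn. Qed.

Lemma smooth_on_minus (f g : R -> R -> R) :
  smooth_on U f -> smooth_on U g -> smooth_on U (fun x y => f x y - g x y).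
Proof.
intros Hf Hg n.
apply (Cn_on_ext n (fun x y => f x y + -1 * g x y)); [intros; ring |].
apply Cn_on_plus; [| apply Cn_on_mult; [apply Cn_on_const |]];
  now apply smooth_on_Cn.
Qed.

Lemma smooth_on_sqr (f : R -> R -> R) :
  smooth_on U f -> smooth_on U (fun x y => f x y ^ 2).
Proof.
intros Hf n.
apply (Cn_on_ext n (fun x y => f x y * f x y)); [intros; ring |].
now apply Cn_on_mult; apply smooth_on_Cn.
Qed.

Lemma smooth_on_ex_dx (f : R -> R -> R) (x y : R) :
  smooth_on U f -> U (x, y) -> ex_derive (fun t => f t y) x.
Proof. intros Hf; now apply (Cn_on_ex_dx 0), smooth_on_Cn. Qed.

Lemma smooth_on_ex_dy (f : R -> R -> R) (x y : R) :
  smooth_on U f -> U (x, y) -> ex_derive (fun t => f x t) y.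
Proof. intros Hf; now apply (Cn_on_ex_dy 0), smooth_on_Cn. Qed.

Lemma dx_dy_comm (f : R -> R -> R) (x y : R) :
  smooth_on U f -> U (x, y) -> dx (dy f) x y = dy (dx f) x y.
Proof.
intros Hf Hxy.
pose proof (smooth_on_dx _ Hf) as Hfx; pose proof (smooth_on_dy _ Hf) as Hfy.
apply (Schwarz f).
- apply open_locally_2d; [intros a b Hab | exact Hxy].
  repeat split.
  + now apply smooth_on_ex_dx.
  + now apply smooth_on_ex_dy.
  + now apply (smooth_on_ex_dx (dy f)).
  + now apply (smooth_on_ex_dy (dx f)).
- apply (Cn_on_continuity 0 (dx (dy f))); [|exact Hxy].
  now apply Cn_on_dx, smooth_on_Cn.
- apply (Cn_on_continuity 0 (dy (dx f))); [|exact Hxy].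
  now apply Cn_on_dy, smooth_on_Cn.
Qed.

(** * Smoothness and first derivatives of [s1] and [s2] *)

Variable v : R -> R -> R.
Hypothesis hv : smooth_on U v.

Lemma smooth_on_s1 : smooth_on U (s1 v).
Proof.
unfold s1.
apply (smooth_on_minus (fun x y => dx v x y ^ 2 - dy v x y ^ 2 + dx (dx v) x y));
  [apply smooth_on_plus; [apply smooth_on_minus; apply smooth_on_sqr |] |];
  auto using smooth_on_dx, smooth_on_dy.
Qed.

Lemma smooth_on_s2 : smooth_on U (s2 v).
Proof.
unfold s2.
apply smooth_on_plus; [apply smooth_on_mult |];
  auto using smooth_on_dx, smooth_on_dy.
Qed.

Hypothesis htz : tzitzeica_on U v.

(* The syntactic match matters: letting [apply] choose between the two lemmas
   makes unification unfold the iterated [Derive]s. *)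
Ltac smooth :=
  repeat split;
  match goal with
  | |- ex_derive (fun t => ?f t _) _ => apply (smooth_on_ex_dx f)
  | |- ex_derive (fun t => ?f _ t) _ => apply (smooth_on_ex_dy f)
  end;
  auto using smooth_on_dx, smooth_on_dy, smooth_on_s1, smooth_on_s2.

Lemma dx_s1 (x y : R) : U (x, y) ->
  dx (s1 v) x y = 2 * dx v x y * dx (dx v) x y - 2 * dy v x y * dx (dy v) x y
                  + dx (dx (dx v)) x y - dx (dy (dy v)) x y.
Proof.
intros Hxy; apply is_derive_unique; unfold s1; auto_derive.
- smooth.
- unfold dx, dy; ring.
Qed.

Lemma dy_s1 (x y : R) : U (x, y) ->
  dy (s1 v) x y = 2 * dx v x y * dy (dx v) x y - 2 * dy v x y * dy (dy v) x y
                  + dy (dx (dx v)) x y - dy (dy (dy v)) x y.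
Proof.
intros Hxy; apply is_derive_unique; unfold s1; auto_derive.
- smooth.
- unfold dx, dy; ring.
Qed.

Lemma dx_s2 (x y : R) : U (x, y) ->
  dx (s2 v) x y = dx (dx v) x y * dy v x y + dx v x y * dx (dy v) x y
                  + dx (dy (dx v)) x y.
Proof.
intros Hxy; apply is_derive_unique; unfold s2; auto_derive.
- smooth.
- unfold dx, dy; ring.
Qed.

Lemma dy_s2 (x y : R) : U (x, y) ->
  dy (s2 v) x y = dy (dx v) x y * dy v x y + dx v x y * dy (dy v) x y
                  + dy (dy (dx v)) x y.
Proof.
intros Hxy; apply is_derive_unique; unfold s2; auto_derive.
- smooth.
- unfold dx, dy; ring.
Qed.

(** * The differentiated Tzitzeica equation and the first-order system for [s1], [s2] *)

Lemma tzitzeica_dx (x y : R) : U (x, y) ->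
  dx (dx (dx v)) x y + dx (dy (dy v)) x y
  = - 4 * (2 * exp (-2 * v x y) + exp (v x y)) * dx v x y.
Proof.
intros Hxy.
(* The x-derivative of the Laplacian is computed twice: by linearity, and from the right-hand side
   of the Tzitzeica equation. *)
transitivity (dx (laplacian v) x y).
- symmetry; apply is_derive_unique; unfold laplacian; auto_derive.
  + smooth.
  + unfold dx, dy; ring.
- rewrite (dx_ext_on _ _ x y htz Hxy).
  apply is_derive_unique; auto_derive.
  + smooth.
  + unfold dx; ring.
Qed.

Lemma tzitzeica_dy (x y : R) : U (x, y) ->
  dy (dx (dx v)) x y + dy (dy (dy v)) x y
  = - 4 * (2 * exp (-2 * v x y) + exp (v x y)) * dy v x y.
Proof.
intros Hxy.
transitivity (dy (laplacian v) x y).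
- symmetry; apply is_derive_unique; unfold laplacian; auto_derive.
  + smooth.
  + unfold dx, dy; ring.
- rewrite (dy_ext_on _ _ x y htz Hxy).
  apply is_derive_unique; auto_derive.
  + smooth.
  + unfold dy; ring.
Qed.

(* Real and imaginary parts of [2 d/dzbar (s1 - 2 i s2) = - 24 e^v v_z],
   where [2 v_z = v_x - i v_y]. *)
Lemma s_CR_re (x y : R) : U (x, y) ->
  dx (s1 v) x y + 2 * dy (s2 v) x y = -12 * (exp (v x y) * dx v x y).
Proof.
intros Hxy.
(* Two exchanges are needed; one takes place under an outer [dy], hence must hold on all of [U]. *)
assert (Hyyx : dy (dy (dx v)) x y = dx (dy (dy v)) x y).
{ rewrite dx_dy_comm by auto using smooth_on_dy.
  apply dy_ext_on; [|exact Hxy].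
  intros a b Hab; symmetry; now apply dx_dy_comm. }
pose proof (htz x y Hxy) as Ht; unfold laplacian in Ht.
pose proof (tzitzeica_dx x y Hxy) as Htx.
rewrite dx_s1, dy_s2, Hyyx, (dx_dy_comm v) by assumption.
(* The terms in v_y v_xy cancel, leaving 2 v_x Δv + (Δv)_x. The coefficients of e^(-2v) v_x are 8
   and -8, those of e^v v_x are -8 and -4. *)
transitivity (2 * dx v x y * (dx (dx v) x y + dy (dy v) x y)
              + (dx (dx (dx v)) x y + dx (dy (dy v)) x y)); [ring |].
rewrite Ht, Htx; ring.
Qed.

Lemma s_CR_im (x y : R) : U (x, y) ->
  dy (s1 v) x y - 2 * dx (s2 v) x y = 12 * (exp (v x y) * dy v x y).
Proof.
intros Hxy.
pose proof (htz x y Hxy) as Ht; unfold laplacian in Ht.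
pose proof (tzitzeica_dy x y Hxy) as Hty.
rewrite dy_s1, dx_s2, (dx_dy_comm v), (dx_dy_comm (dx v))
  by auto using smooth_on_dx.
(* Here the terms in v_x v_xy cancel, leaving -2 v_y Δv - (Δv)_y. *)
transitivity (- 2 * dy v x y * (dx (dx v) x y + dy (dy v) x y)
              - (dy (dx (dx v)) x y + dy (dy (dy v)) x y)); [ring |].
rewrite Ht, Hty; ring.
Qed.

(** * Derivatives of the right-hand sides of the first-order system *)

Lemma dx_exp_mult_dx (c x y : R) : U (x, y) ->
  dx (fun a b => c * (exp (v a b) * dx v a b)) x y
  = c * (exp (v x y) * (dx v x y ^ 2 + dx (dx v) x y)).
Proof.
intros Hxy; apply is_derive_unique; auto_derive.
- smooth.
- unfold dx; ring.
Qed.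

(** The last factor is [s2 v x y] written out; the same factor arises from the x-derivative of e^v
    v_y. *)
Lemma dy_exp_mult_dx (c x y : R) : U (x, y) ->
  dy (fun a b => c * (exp (v a b) * dx v a b)) x y
  = c * (exp (v x y) * (dx v x y * dy v x y + dy (dx v) x y)).
Proof.
intros Hxy; apply is_derive_unique; auto_derive.
- smooth.
- unfold dx, dy; ring.
Qed.

Lemma dx_exp_mult_dy (c x y : R) : U (x, y) ->
  dx (fun a b => c * (exp (v a b) * dy v a b)) x y
  = c * (exp (v x y) * (dx v x y * dy v x y + dy (dx v) x y)).
Proof.
intros Hxy; rewrite <- (dx_dy_comm v) by assumption.
apply is_derive_unique; auto_derive.
- smooth.
- unfold dx, dy; ring.
Qed.

Lemma dy_exp_mult_dy (c x y : R) : U (x, y) ->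
  dy (fun a b => c * (exp (v a b) * dy v a b)) x y
  = c * (exp (v x y) * (dy v x y ^ 2 + dy (dy v) x y)).
Proof.
intros Hxy; apply is_derive_unique; auto_derive.
- smooth.
- unfold dy; ring.
Qed.

(** * The second-order equations for [s1] and [s2] *)

Lemma laplacian_s1 (x y : R) : U (x, y) ->
  laplacian (s1 v) x y = - 12 * exp (v x y) * s1 v x y.
Proof.
intros Hxy.
assert (Hre : dx (dx (s1 v)) x y + 2 * dx (dy (s2 v)) x y
              = -12 * (exp (v x y) * (dx v x y ^ 2 + dx (dx v) x y))).
(* Read backwards, the right-hand side is the x-derivative of that of [s_CR_re], which is then
   traded for the left-hand side. *)
{ rewrite <- dx_exp_mult_dx, <- (dx_ext_on _ _ x y s_CR_re Hxy) by exact Hxy.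
  symmetry; apply is_derive_unique; auto_derive.
  - smooth.
  - unfold dx, dy; ring. }
assert (Him : dy (dy (s1 v)) x y - 2 * dy (dx (s2 v)) x y
              = 12 * (exp (v x y) * (dy v x y ^ 2 + dy (dy v) x y))).
{ rewrite <- dy_exp_mult_dy, <- (dy_ext_on _ _ x y s_CR_im Hxy) by exact Hxy.
  symmetry; apply is_derive_unique; auto_derive.
  - smooth.
  - unfold dx, dy; ring. }
(* Once the mixed derivatives of [s2] agree, adding [Hre] and [Him] eliminates them. Only the
   undifferentiated [s1] is unfolded below. *)
rewrite (dx_dy_comm _ _ _ smooth_on_s2 Hxy) in Hre.
unfold laplacian, s1 at 3; lra.
Qed.

Lemma laplacian_s2 (x y : R) : U (x, y) ->
  laplacian (s2 v) x y = - 12 * exp (v x y) * s2 v x y.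
Proof.
intros Hxy.
assert (Hre : dy (dx (s1 v)) x y + 2 * dy (dy (s2 v)) x y
              = -12 * (exp (v x y) * (dx v x y * dy v x y + dy (dx v) x y))).
{ rewrite <- dy_exp_mult_dx, <- (dy_ext_on _ _ x y s_CR_re Hxy) by exact Hxy.
  symmetry; apply is_derive_unique; auto_derive.
  - smooth.
  - unfold dx, dy; ring. }
assert (Him : dx (dy (s1 v)) x y - 2 * dx (dx (s2 v)) x y
              = 12 * (exp (v x y) * (dx v x y * dy v x y + dy (dx v) x y))).
{ rewrite <- dx_exp_mult_dy, <- (dx_ext_on _ _ x y s_CR_im Hxy) by exact Hxy.
  symmetry; apply is_derive_unique; auto_derive.
  - smooth.
  - unfold dx, dy; ring. }
(* Now [Hre] minus [Him] eliminates the mixed derivatives of [s1] and gives twice the claim. *)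
rewrite (dx_dy_comm _ _ _ smooth_on_s1 Hxy) in Him.
unfold laplacian, s2 at 3; lra.
Qed.

End Open_domain.

Lemma eigenfunction_on_conformal (U : R * R -> Prop) (v s : R -> R -> R)
    (lambda : R) :
  smooth_on U s ->
  (forall x y : R, U (x, y) ->
    laplacian s x y = - (2 * lambda) * exp (v x y) * s x y) ->
  eigenfunction_on U (conformal_metric v) lambda s.
Proof.
intros Hs Hl; split; [exact Hs |]; intros x y Hxy.
rewrite laplace_beltrami_conformal, Hl by exact Hxy.
(* The factor 2 e^v carried by the flat equation cancels the conformal factor of the metric, leaving
   [lambda]. *)
field; apply Rgt_not_eq, exp_pos.
Qed.

Theorem theorem3 (U : R * R -> Prop) (v : R -> R -> R)
    (hU : open U)
    (hv : smooth_on U v)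
    (htz : tzitzeica_on U v) :
  eigenfunction_on U (conformal_metric v) 6 (s1 v) /\
  eigenfunction_on U (conformal_metric v) 6 (s2 v).
Proof.
split; apply eigenfunction_on_conformal.
- now apply smooth_on_s1.
- intros x y Hxy; replace (- (2 * 6)) with (-12) by ring.
  now apply (laplacian_s1 U).
- now apply smooth_on_s2.
- intros x y Hxy; replace (- (2 * 6)) with (-12) by ring.
  now apply (laplacian_s2 U).
Qed.
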